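(* For a Chomp board $B$ (a finite set of cells $(x,y)$, $x,y$ positive integers, such that $(x,y)\in B$, $1\le p\le x$, $1\le q\le y$ imply $(p,q)\in B$), let $\mathbb{E}[B]$ denote the expected number of turns of random Chomp started from $B$ (each turn the player to move chooses a cell $(x,y)$ of the current board uniformly at random, independently, and removes all cells $(p,q)$ with $p\ge x$, $q\ge y$; the game ends when the board is empty). Let $H_N=\sum_{j=1}^N \frac1j$. There is a function $\varepsilon(N)$ with $\varepsilon(N)\to0$ as $N\to\infty$ such that every Chomp board $B$ with $N$ cells satisfies \[ H_N \le \mathbb{E}[B] \le \left(\tfrac12+\varepsilon(N)\right) H_N^2 . \] Moreover, there are boards having $N$ cells attaining these lower and upper bounds.
   Context: Cells are indexed by row $x$ and column $y$, with $(1,1)$ the top-left cell. *)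

(* Defs.v *)
From HB Require Import structures.
From mathcomp Require Import all_boot all_order all_algebra finmap.
From mathcomp Require Import all_classical all_reals all_analysis.
Set Implicit Arguments.
Unset Strict Implicit.
Unset Printing Implicit Defensive.
Import Order.TTheory GRing.Theory Num.Theory numFieldNormedType.Exports.
Local Open Scope classical_set_scope.
Local Open Scope ring_scope.

Notation cell := (nat * nat)%type.

(* Rows and columns are numbered from 1, so (0, y) and (x, 0) are not cells
   of any board. *)
Definition chomp_board (B : {fset cell}) : Prop :=
  (forall x y : nat, (x, y) \in B -> (1 <= x)%N /\ (1 <= y)%N) /\
  (forall x y p q : nat, (x, y) \in B ->
     (1 <= p <= x)%N -> (1 <= q <= y)%N -> (p, q) \in B).

Definition bite (B : {fset cell}) (c : cell) : {fset cell} :=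
  [fset d in B | ~~ ((c.1 <= d.1)%N && (c.2 <= d.2)%N)]%fset.

(* [complete_play B s]: [s] is the sequence of cells chosen, in order, in a game
   that starts from [B] and runs until the board is empty.  The number of turns
   of that game is [size s]. *)
Fixpoint complete_play (B : {fset cell}) (s : seq cell) : bool :=
  if s is c :: s' then (c \in B) && complete_play (bite B c) s'
  else B == fset0.

(* The choices being independent and uniform on the current board, a play has
   for probability the product of the 1 / #|current board| over its turns. *)
Fixpoint play_prob (R : realType) (B : {fset cell}) (s : seq cell) : R :=
  if s is c :: s' then (#|` B|%:R)^-1 * play_prob R (bite B c) s' else 1.

(* [\sum_(s \in A)] is the sum over a set, meaningful when the support of the
   summand in [A] is finite; see [finite_complete_plays] below. *)
Definition expected_turns (R : realType) (B : {fset cell}) : R :=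
  \sum_(s \in [set s | complete_play B s]) play_prob R B s * (size s)%:R.

Definition harmonic_number (R : realType) (N : nat) : R :=
  \sum_(1 <= j < N.+1) (j%:R)^-1.

Lemma bite_proper B c : c \in B -> (#|` bite B c| < #|` B|)%N.
Proof.
move=> cB; apply: fproper_ltn_card; rewrite fproperE; apply/andP; split.
  by apply/fsubsetP => d; rewrite !inE => /andP[].
by apply/negP => /fsubsetP /(_ c cB); rewrite !inE /= !leqnn andbF.
Qed.

Lemma complete_plays_cons B : B != fset0 ->
  [set s | complete_play B s] =
  \bigcup_(c in [set` B]) (cons c @` [set s | complete_play (bite B c) s]).
Proof.
move=> B0; apply/seteqP; split=> [[|c s]|s [c /= cB [t /= tB <-]]] /=.
- by rewrite (negbTE B0).
- by move=> /andP[cB sB]; exists c => //=; exists s.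
- by rewrite cB.
Qed.

Lemma finite_complete_plays B : finite_set [set s | complete_play B s].
Proof.
have [n] := ubnP #|` B|; elim: n => // n IH in B *; rewrite ltnS => Bn.
have [->|B0] := eqVneq B fset0.
  by apply: (@sub_finite_set _ _ [set [::]]) => //; case=> [|c s] //=; rewrite inE.
rewrite complete_plays_cons//; apply: bigcup_finite => // c /= cB.
by apply: finite_image; apply: IH; exact: leq_trans (bite_proper cB) Bn.
Qed.

Lemma sum_complete_plays (R : realType) B (F : seq cell -> R) : B != fset0 ->
  \sum_(s \in [set s | complete_play B s]) F s =
  \sum_(c <- B) \sum_(s \in [set s | complete_play (bite B c) s]) F (c :: s).
Proof.
move=> B0.
pose G c s := if complete_play B s && (ohead s == Some c) then F s else 0.
transitivity (\sum_(s \in [set s | complete_play B s]) \sum_(c <- B) G c s).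
  apply: eq_fsbigr => -[|c s]; rewrite inE /=; first by rewrite (negbTE B0).
  move=> /andP[cB sB]; rewrite (big_fsetD1 c)//= /G /= cB sB eqxx/=.
  rewrite big_seq big1 ?addr0// => d; rewrite !inE => /andP[dc _].
  by case: eqP => // -[cd]; rewrite cd eqxx in dc.
rewrite fsbig_finite/=; last exact: finite_complete_plays.
rewrite exchange_big/=; apply: eq_big_seq => c cB.
rewrite -fsbig_finite/=; last exact: finite_complete_plays.
have inj : set_inj [set s | complete_play (bite B c) s] (cons c).
  by move=> s t _ _ [].
rewrite -(fsbig_image _ _ F inj).
rewrite (@fsbig_mkcond _ _ _ _ _ (G c)) [RHS]fsbig_mkcond/=.
apply: eq_fsbigr => s _; rewrite /patch /G.
have -> : (s \in cons c @` [set s | complete_play (bite B c) s]) =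
    complete_play B s && (ohead s == Some c).
  apply/idP/idP.
    by rewrite inE/= => -[t tB <-] /=; rewrite cB tB eqxx.
  case: s => [|d s]; first by rewrite andbF.
  by move=> /= /andP[/andP[dB sB] /eqP[<-]]; rewrite inE; exists s.
have -> : (s \in [set s | complete_play B s]) = complete_play B s.
  by apply/idP/idP; rewrite inE.
by case: (complete_play B s).
Qed.

(* The weights [play_prob] do form a probability distribution on complete
   plays. *)
Lemma sum_play_prob (R : realType) B :
  \sum_(s \in [set s | complete_play B s]) play_prob R B s = 1.
Proof.
have [n] := ubnP #|` B|; elim: n => // n IH in B *; rewrite ltnS => Bn.
have [->|B0] := eqVneq B fset0.
  rewrite (_ : [set s | _] = [set [::]]) ?fsbig_set1//.
  by apply/seteqP; split=> [[|c s]|s] //= ->.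
rewrite sum_complete_plays//= (eq_big_seq (fun=> (#|` B|%:R)^-1)) => [|c cB].
  rewrite big_const_seq count_predT iter_addr_0 -[X in X = _]mulr_natl.
  by rewrite divff// pnatr_eq0 cardfs_eq0.
rewrite -mulr_fsumr IH ?mulr1//; exact: leq_trans (bite_proper cB) Bn.
Qed.

(* Main.v *)
(** Write w(x, y) = 1 / (xy) and W(B) for the sum of w over the cells of B.
    A cell (x, y) of B is removed by exactly xy of the possible first moves, so
    the average of W(bite B c) over c is W(B) - 1, and hence E[B] = W(B).

    Lower bound: a maximal cell (x, y) of B has xy <= #|B|, so removing it takes
    at least 1 / #|B| away from W(B).  A single row attains equality.

    Upper bound: every cell of B satisfies xy <= N, and
      sum_(xy <= n) 1 / (xy) = sum_(x <= n) H_(n / x) / x = H_n ^ 2 / 2 + O(H_n),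
    because H is additive on products up to an error at most 1.  A largest value
    of W is attained by taking cells greedily by increasing product xy.  That
    value dominates the sum over {xy <= n} for n = N / k with k ~ H_N, since this
    region has at most n H_n <= N cells; and H_n >= H_N - H_k is H_N - o(H_N). *)
Require Import Defs.
From HB Require Import structures.
From mathcomp Require Import all_boot all_order all_algebra finmap.
From mathcomp Require Import all_classical all_reals all_analysis.
From mathcomp Require Import ring lra zify.
Set Implicit Arguments.
Unset Strict Implicit.
Unset Printing Implicit Defensive.
Import Order.TTheory GRing.Theory Num.Theory numFieldNormedType.Exports.
Local Open Scope classical_set_scope.
Local Open Scope ring_scope.

(** * Expected number of turns as the total weight of the board *)

Definition cell_le (c d : cell) : bool := (c.1 <= d.1)%N && (c.2 <= d.2)%N.

Definition cell_weight (R : realType) (c : cell) : R := (c.1 * c.2)%N%:R^-1.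

Definition board_weight (R : realType) (B : {fset cell}) : R :=
  \sum_(c <- B) cell_weight R c.

Lemma cell_weight_ge0 (R : realType) c : 0 <= cell_weight R c.
Proof. by rewrite invr_ge0. Qed.

Lemma big_fset_uniq (V : nmodType) (T : choiceType) (B : {fset T}) (s : seq T)
    (F : T -> V) : uniq s -> B =i s -> \sum_(c <- B) F c = \sum_(c <- s) F c.
Proof. by move=> us Bs; apply: perm_big; apply: uniq_perm. Qed.

Lemma card_fset_uniq (T : choiceType) (B : {fset T}) (s : seq T) :
  uniq s -> B =i s -> #|` B| = size s.
Proof. by move=> us Bs; apply: perm_size; apply: uniq_perm. Qed.

Lemma bite_board B c : chomp_board B -> chomp_board (bite B c).
Proof.
move=> [Bpos Bdown]; split=> [x y|x y p q]; rewrite !inE/=.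
  by move=> /andP[/Bpos].
move=> /andP[xyB xyc] px qy; rewrite (Bdown x y)//=.
by apply: contra xyc => /andP[cp cq]; lia.
Qed.

Lemma card_cells_below B d : chomp_board B -> d \in B ->
  #|` [fset c in B | cell_le c d]%fset| = (d.1 * d.2)%N.
Proof.
case: d => x y [Bpos Bdown] xyB.
rewrite (@card_fset_uniq _ _ [seq (p, q) | p <- iota 1 x, q <- iota 1 y]).
- by rewrite size_allpairs !size_iota.
- by apply: allpairs_uniq; rewrite ?iota_uniq// => -[? ?] [? ?].
- move=> [p q]; rewrite !inE/=; apply/andP/allpairsP => [[pqB /andP[/= px qy]]|].
    by have [? ?] := Bpos _ _ pqB; exists (p, q); rewrite !mem_iota/=; split=> //; lia.
  move=> [[p' q'] /= []]; rewrite !mem_iota => px qy [-> ->].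
  by rewrite /cell_le/=; split; [apply: Bdown xyB _ _; lia|lia].
Qed.

(** Double counting of pairs (first move, removed cell): a cell [d] is lost in [d.1 * d.2] moves,
    each costing the inverse of that number, so it contributes exactly 1. *)
Lemma sum_bite_weight (R : realType) B : chomp_board B ->
  \sum_(c <- B) board_weight R (bite B c) + #|` B|%:R =
  #|` B|%:R * board_weight R B.
Proof.
move=> chB.
have -> : #|` B|%:R * board_weight R B = \sum_(c <- B) board_weight R B.
  by rewrite big_const_seq count_predT iter_addr_0 mulr_natl.
have -> : #|` B|%:R = \sum_(c <- B)
    \sum_(d <- [fset d in B | cell_le c d]%fset) cell_weight R d.
  under eq_bigr do rewrite big_fset/= big_mkcond.
  rewrite exchange_big/= card_fset_sum1 natr_sum; apply: eq_big_seq => -[x y] xyB.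
  rewrite -big_mkcond/= big_fset_condE big_const_seq count_predT iter_addr_0.
  rewrite card_cells_below//= /cell_weight/= -[RHS]mulr_natl mulfV// pnatr_eq0.
  by have [? ?] := chB.1 _ _ xyB; rewrite muln_eq0; lia.
rewrite -big_split/=; apply: eq_bigr => c _.
by rewrite addrC -(big_fsetID +%R (cell_le c)).
Qed.

(** Conditioning on the first move; the turn it uses adds total probability 1 for each [c], which is
    where [sum_play_prob] enters. *)
Lemma expected_turns_rec (R : realType) B : B != fset0 ->
  #|` B|%:R * expected_turns R B =
  \sum_(c <- B) expected_turns R (bite B c) + #|` B|%:R.
Proof.
move=> B0; rewrite {1}/expected_turns sum_complete_plays//=.
have cB0 : #|` B|%:R != 0 :> R by rewrite pnatr_eq0 cardfs_eq0.
rewrite [X in _ + X%:R]card_fset_sum1 natr_sum -big_split mulr_sumr/=.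
apply: eq_bigr => c _; rewrite -[X in _ = _ + X](sum_play_prob R (bite B c)).
rewrite mulr_fsumr -fsbig_split/=; last exact: finite_complete_plays.
by apply: eq_fsbigr => s _; rewrite -mulrA mulVKf// -natr1 mulrDr mulr1.
Qed.

Lemma expected_turnsE (R : realType) B : chomp_board B ->
  expected_turns R B = board_weight R B.
Proof.
have [n] := ubnP #|` B|; elim: n => // n IH in B *; rewrite ltnS => Bn chB.
have [->|B0] := eqVneq B fset0.
  rewrite /board_weight big_seq_fset0 /expected_turns.
  rewrite (_ : [set s | _] = [set [::]]) ?fsbig_set1 ?mulr0//.
  by apply/seteqP; split=> [[|c s]|s] //= ->.
have cB0 : #|` B|%:R != 0 :> R by rewrite pnatr_eq0 cardfs_eq0.
apply: (mulfI cB0); rewrite expected_turns_rec// -sum_bite_weight//.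
congr (_ + _); apply: eq_big_seq => c cB; apply: IH; last exact: bite_board.
exact: leq_trans (bite_proper cB) Bn.
Qed.

(** * Estimates for harmonic numbers *)

Lemma harmonicS (R : realType) n :
  harmonic_number R n.+1 = harmonic_number R n + n.+1%:R^-1.
Proof. by rewrite /harmonic_number big_nat_recr. Qed.

Lemma harmonic0 (R : realType) : harmonic_number R 0 = 0.
Proof. by rewrite /harmonic_number big_geq. Qed.

Lemma harmonic1 (R : realType) : harmonic_number R 1 = 1.
Proof. by rewrite harmonicS harmonic0 add0r invr1. Qed.

Lemma harmonic_le (R : realType) : {homo harmonic_number R : m n / (m <= n)%N >-> m <= n}.
Proof.
apply: homo_leq => [x//|y x z|n]; first exact: le_trans.
by rewrite harmonicS lerDl invr_ge0.
Qed.

Lemma harmonic_ge0 (R : realType) n : 0 <= harmonic_number R n.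
Proof. by rewrite -(harmonic0 R); exact: harmonic_le. Qed.

Lemma harmonic_block_le (R : realType) a m : (0 < a)%N ->
  harmonic_number R (a + m) <= harmonic_number R a + m%:R / a%:R.
Proof.
move=> a0; elim: m => [|m IH]; first by rewrite addn0 mul0r addr0.
rewrite addnS harmonicS -[m.+1%:R]natr1 mulrDl mul1r addrA lerD// lef_pV2 ?posrE ?ltr0n//.
by rewrite ler_nat; lia.
Qed.

Lemma harmonic_block_ge (R : realType) a m c : (a + m <= c)%N ->
  harmonic_number R a + m%:R / c%:R <= harmonic_number R (a + m).
Proof.
elim: m => [|m IH] amc; first by rewrite addn0 mul0r addr0.
rewrite addnS harmonicS -[m.+1%:R]natr1 mulrDl mul1r addrA lerD ?IH//; first lia.
by rewrite lef_pV2 ?posrE ?ltr0n// ?ler_nat; lia.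
Qed.

(** Cut the terms into blocks of length [m]: the block following [m * j] sums to at most m / (m j) =
    1 / j, for j = 1, ..., k. *)
Lemma harmonic_mul_le (R : realType) m k :
  harmonic_number R (m * k.+1) <= harmonic_number R m + harmonic_number R k.
Proof.
case: m => [|m]; first by rewrite mul0n harmonic0 add0r harmonic_ge0.
elim: k => [|k IH]; first by rewrite muln1 harmonic0 addr0.
rewrite mulnS addnC (le_trans (harmonic_block_le _ _ _))//.
rewrite (harmonicS R k) addrA lerD// natrM invfM mulrA divff ?pnatr_eq0//.
by rewrite mul1r.
Qed.

(** Same blocks from below: the block ending at [m * j] sums to at least 1 / j, for j = 2, ..., k +
    1. *)
Lemma harmonic_mul_ge (R : realType) m k : (0 < m)%N ->
  harmonic_number R m + harmonic_number R k.+1 - 1 <= harmonic_number R (m * k.+1).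
Proof.
move=> m0; elim: k => [|k IH]; first by rewrite muln1 harmonic1 addrK.
rewrite [in leRHS]mulnS addnC.
apply: le_trans (@harmonic_block_ge _ _ _ (m * k.+2)%N _); last by lia.
rewrite harmonicS natrM invfM mulrA divff ?pnatr_eq0 -?lt0n// mul1r.
by rewrite addrA [leLHS]addrAC lerD.
Qed.

(** A crude bound, enough to make H_k negligible against H_N when k is of order H_N. *)
Lemma harmonic_le_sqrt (R : realType) n :
  harmonic_number R n <= 2 * Num.sqrt n%:R.
Proof.
elim: n => [|n IH]; first by rewrite harmonic0 mulr_ge0.
rewrite harmonicS.
set s := Num.sqrt n%:R in IH *; set t := Num.sqrt n.+1%:R.
have s0 : 0 <= s by rewrite sqrtr_ge0.
have t1 : 1 <= t by rewrite -(@sqrtr1 R) ler_sqrt// ler1n.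
have st : s <= t by rewrite ler_sqrt// ler_nat.
have E : t ^+ 2 = s ^+ 2 + 1 by rewrite !sqr_sqrtr// mulrSr.
have -> : n.+1%:R = t ^+ 2 by rewrite sqr_sqrtr.
have t2 : t^-1 <= 1 by rewrite invf_le1//; lra.
have tt : t * t^-1 = 1 by rewrite divff//; lra.
rewrite -exprVn.
(* Telescoping: 2 (t - s) = 2 / (t + s) >= 1 / t >= 1 / t ^ 2. *)
suff : t^-1 ^+2 <= 2 * (t - s) by lra.
have : (t - s) * (t + s) = 1 by nra.
have : t^-1 <= 2 * (t - s) by nra.
have : 0 <= t^-1 by rewrite invr_ge0; lra.
by nra.
Qed.

(** The sum equals half of H_n ^ 2 + sum 1 / x ^ 2, and 0 <= 1 / x ^ 2 <= 1 / x. *)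
Lemma sum_harmonic_div (R : realType) n :
  harmonic_number R n ^+ 2 / 2 <=
  \sum_(1 <= x < n.+1) harmonic_number R x / x%:R <=
  harmonic_number R n ^+ 2 / 2 + harmonic_number R n / 2.
Proof.
elim: n => [|n]; first by rewrite big_geq// harmonic0; lra.
rewrite [X in _ -> is_true (_ <= X <= _)]big_nat_recr//= harmonicS.
set a := harmonic_number R n; set S := \sum_(_ <= _ < _) _; set u := n.+1%:R^-1.
have u0 : 0 <= u by rewrite invr_ge0.
have u1 : u <= 1 by rewrite invf_le1// ler1n.
by nra.
Qed.

(** * Lower bound *)

Lemma fset_max (T : choiceType) (B : {fset T}) (f : T -> nat) : B != fset0 ->
  exists2 c, c \in B & forall d, d \in B -> (f d <= f c)%N.
Proof.
move=> /fset0Pn[c0 c0B].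
have [] := @ex_maxnP (fun n => has (fun c => f c == n) B) (\sum_(c <- B) f c)%N.
- by exists (f c0); apply/hasP; exists c0.
- by move=> n /hasP[c cB /eqP<-]; rewrite (big_fsetD1 c)//= leq_addr.
- move=> n /hasP[c cB /eqP cn] nmax; exists c => // d dB.
  by rewrite cn nmax//; apply/hasP; exists d.
Qed.

Lemma board_product_le B x y : chomp_board B -> (x, y) \in B ->
  (x * y <= #|` B|)%N.
Proof.
move=> chB xyB; rewrite -(card_cells_below chB xyB).
by apply: fsubset_leq_card; apply/fsubsetP => c; rewrite !inE => /andP[].
Qed.

Lemma board_weight_ge (R : realType) B : chomp_board B ->
  harmonic_number R #|` B| <= board_weight R B.
Proof.
have [n] := ubnP #|` B|; elim: n => // n IH in B *; rewrite ltnS => Bn chB.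
have [->|B0] := eqVneq B fset0.
  by rewrite cardfs0 harmonic0 /board_weight big_seq_fset0.
(* A cell maximising the coordinate sum has no other cell of [B] beyond it, so biting there removes
   that cell alone. *)
have [[x y] xyB xymax] := fset_max (fun c : cell => c.1 + c.2)%N B0.
have [x0 y0] := chB.1 _ _ xyB.
have biteE : bite B (x, y) = (B `\ (x, y))%fset.
  apply/fsetP => -[p q]; rewrite !inE/= andbC; case pqB: (_ \in B); last by rewrite !andbF.
  have /= := xymax _ pqB; rewrite !andbT xpair_eqE => pq; congr (~~ _).
  by apply/idP/idP; lia.
have chD := bite_board (x, y) chB; rewrite biteE in chD.
have cardB := cardfsD1 (x, y) B; rewrite xyB add1n in cardB.
rewrite /board_weight (big_fsetD1 (x, y))//= addrC cardB harmonicS.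
rewrite lerD ?IH//; first by lia.
rewrite -cardB lef_pV2 ?posrE ?ltr0n ?ler_nat ?muln_gt0 ?x0 ?y0//=.
- exact: board_product_le.
- by rewrite cardfs_gt0.
Qed.

(** * Weight of the region xy <= n and the upper bound *)

Definition hyperbola (n : nat) : seq cell :=
  [seq (x, y) | x <- index_iota 1 n.+1, y <- index_iota 1 (n %/ x).+1].

Lemma mem_hyperbola n x y :
  ((x, y) \in hyperbola n) = [&& (0 < x)%N, (0 < y)%N & (x * y <= n)%N].
Proof.
apply/allpairsPdep/and3P => [[p [q []]]|[x0 y0 xyn]].
  rewrite !mem_index_iota => /andP[p0 pn] /andP[q0 qn] [-> ->]; split=> //.
  by rewrite mulnC -leq_divRL.
exists x, y; rewrite !mem_index_iota x0 y0/= !ltnS leq_divRL// mulnC xyn.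
by split=> //; apply: leq_trans xyn; rewrite leq_pmulr.
Qed.

Lemma hyperbola_uniq n : uniq (hyperbola n).
Proof.
apply: allpairs_uniq_dep => [|x _|]; rewrite ?iota_uniq//.
by move=> [x y] [p q] _ _ /= [-> ->].
Qed.

Lemma sum_hyperbola (R : realType) n :
  \sum_(c <- hyperbola n) cell_weight R c =
  \sum_(1 <= x < n.+1) harmonic_number R (n %/ x) / x%:R.
Proof.
rewrite big_allpairs_dep; apply: eq_bigr => x _.
rewrite mulr_suml; apply: eq_bigr => y _.
by rewrite /cell_weight/= natrM invfM mulrC.
Qed.

Lemma size_hyperbola_le (R : realType) n :
  (size (hyperbola n))%:R <= n%:R * harmonic_number R n.
Proof.
rewrite size_allpairs_dep sumnE big_map natr_sum mulr_sumr.
rewrite big_seq [leRHS]big_seq; apply: ler_sum => x; rewrite mem_index_iota.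
move=> /andP[x0 _]; rewrite size_iota subn1/= ler_pdivlMr ?ltr0n//.
by rewrite -natrM ler_nat leq_trunc_div.
Qed.

(** By [harmonic_mul_ge], H_(n / x) <= H_n + 1 - H_x; after division by x, the sum of H_x / x is at
    least H_n ^ 2 / 2. *)
Lemma sum_hyperbola_le (R : realType) n :
  \sum_(c <- hyperbola n) cell_weight R c <=
  harmonic_number R n ^+ 2 / 2 + harmonic_number R n.
Proof.
rewrite sum_hyperbola.
have : \sum_(1 <= x < n.+1) harmonic_number R (n %/ x) / x%:R <=
    \sum_(1 <= x < n.+1) ((harmonic_number R n + 1) * x%:R^-1 -
                         harmonic_number R x / x%:R).
  rewrite big_nat [leRHS]big_nat; apply: ler_sum => x /andP[x0 xn].
  rewrite -mulrBl ler_wpM2r ?invr_ge0//.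
  case E : (n %/ x)%N => [|q].
    by rewrite harmonic0; have := @harmonic_le R x n; rewrite -ltnS xn => /(_ isT); lra.
  have := harmonic_mul_ge R q x0; have : (x * q.+1 <= n)%N.
    by rewrite -E mulnC leq_trunc_div.
  by move=> /(@harmonic_le R); lra.
rewrite sumrB -mulr_sumr -/(harmonic_number R n).
have /andP[+ _] := sum_harmonic_div R n; set S := \sum_(_ <= _ < _) (_ / _).
by nra.
Qed.

Lemma harmonic_divn_le (R : realType) n x : (0 < x)%N ->
  harmonic_number R n <= harmonic_number R x + harmonic_number R (n %/ x).
Proof.
move=> x0; apply: le_trans (harmonic_mul_le _ _ _).
by apply: harmonic_le; rewrite mulnC ltnW// ltn_ceil.
Qed.

(** Counterpart of [sum_hyperbola_le], from H_(n / x) >= H_n - H_x. *)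
Lemma sum_hyperbola_ge (R : realType) n :
  harmonic_number R n ^+ 2 / 2 - harmonic_number R n / 2 <=
  \sum_(c <- hyperbola n) cell_weight R c.
Proof.
rewrite sum_hyperbola.
have : \sum_(1 <= x < n.+1) (harmonic_number R n * x%:R^-1 -
                         harmonic_number R x / x%:R) <=
    \sum_(1 <= x < n.+1) harmonic_number R (n %/ x) / x%:R.
  rewrite big_nat [leRHS]big_nat; apply: ler_sum => x /andP[x0 xn].
  rewrite -mulrBl ler_wpM2r ?invr_ge0//.
  by have := harmonic_divn_le R n x0; lra.
rewrite sumrB -mulr_sumr -/(harmonic_number R n).
have /andP[_ +] := sum_harmonic_div R n; set S := \sum_(_ <= _ < _) (_ / _).
by nra.
Qed.

Lemma board_weight_le (R : realType) B : chomp_board B ->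
  board_weight R B <=
  harmonic_number R #|` B| ^+ 2 / 2 + harmonic_number R #|` B|.
Proof.
move=> chB; apply: le_trans (sum_hyperbola_le _ _).
pose Y := [fset c in hyperbola #|` B|]%fset.
have YE : Y =i hyperbola #|` B| by move=> c; rewrite !inE.
rewrite -(@big_fset_uniq _ _ Y)//; last exact: hyperbola_uniq.
have BY : (B `<=` Y)%fset.
  apply/fsubsetP => -[x y] xyB; rewrite YE mem_hyperbola board_product_le//.
  by have [-> ->] := chB.1 _ _ xyB.
rewrite (big_fsetID +%R (mem B) Y)/= /board_weight.
rewrite (@eq_fbigl _ _ _ _ B [fset c in Y | c \in B]%fset) => [|c].
  by rewrite lerDl sumr_ge0// => c _; exact: cell_weight_ge0.
by rewrite !inE/= andbC; case cB: (c \in B) => //=; rewrite -YE (fsubsetP BY).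
Qed.

(** * Greedy boards and their optimality *)

Definition positive_cell (c : cell) : bool := (0 < c.1 * c.2)%N.

(** Cells are added by increasing product; [m] is a threshold between the products taken and those
    left out. *)
Lemma greedy_board N : exists B : {fset cell}, exists m : nat,
  [/\ chomp_board B, #|` B| = N,
      forall c, c \in B -> (c.1 * c.2 <= m)%N &
      forall c, positive_cell c -> c \notin B -> (m <= c.1 * c.2)%N].
Proof.
elim: N => [|N [B [m [chB cardB Bm mB]]]].
  by exists fset0, 0%N; split.
pose free n := `[< exists2 c, positive_cell c && (c \notin B) & (c.1 * c.2)%N = n >].
have exfree : exists n, free n.
  (* A board with N cells has all products at most N, so it misses (1, N + 1). *)
  exists N.+1; apply/asboolP; exists (1, N.+1)%N; rewrite /positive_cell/= ?mul1n//.
  by apply/negP => /(board_product_le chB); rewrite cardB mul1n ltnn.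
have [n /asboolP[[x y] /andP[xy0 xyB] xyn] nmin] := ex_minnP exfree.
have free_le c : positive_cell c -> c \notin B -> (n <= c.1 * c.2)%N.
  by move=> c0 cB; apply: nmin; apply/asboolP; exists c => //; rewrite c0.
move: xy0; rewrite /positive_cell/= muln_gt0 => /andP[x0 y0].
exists ((x, y) |` B)%fset, n; split.
- split=> [p q|p q p' q']; rewrite !inE => /orP[/eqP[-> ->]//|pqB].
  + exact: chB.1 pqB.
  (* A positive cell below (x, y) and outside [B] has product at least [n], the product of (x, y),
     so it is (x, y) itself. *)
  + move=> /andP[p'0 p'x] /andP[q'0 q'y]; rewrite -implyNb; apply/implyP.
    apply: contraNT => pqB'; have := free_le (p', q').
    rewrite /positive_cell/= muln_gt0 p'0 q'0 => /(_ isT pqB'); rewrite -xyn/=.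
    by move=> xy_le; rewrite xpair_eqE; nia.
  + by move=> p'p q'q; rewrite (chB.2 _ _ _ _ pqB)// orbT.
- by rewrite cardfsU1 xyB cardB.
- move=> c; rewrite !inE => /orP[/eqP->|/Bm cm]; first by rewrite xyn.
  apply: leq_trans cm _; rewrite -xyn; apply: mB => //.
  by rewrite /positive_cell muln_gt0 x0.
- by move=> c c0; rewrite !inE negb_or => /andP[_]; exact: free_le.
Qed.

(** Exchange argument: each cell of A \ B weighs at most 1 / m, each cell of B \ A at least 1 / m,
    and the former are no more numerous. Competitors range over all sets of positive cells, so
    hyperbola regions qualify directly. *)
Lemma optimal_board (R : realType) N : exists B : {fset cell},
  [/\ chomp_board B, #|` B| = N &
      forall A : {fset cell}, {in A, forall c, positive_cell c} ->
        (#|` A| <= N)%N -> board_weight R A <= board_weight R B].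
Proof.
have [B [m [chB cardB Bm mB]]] := greedy_board N; exists B; split=> // A A0 cardA.
have Bpos c : c \in B -> positive_cell c.
  by case: c => x y /chB.1[x0 y0]; rewrite /positive_cell/= muln_gt0 x0.
(* If [B] is empty then N = 0 and [A] is empty too; otherwise m > 0 and 1 / m is a genuine
   weight. *)
have [B0|[c0 c0B]] := fset_0Vmem B.
  suff -> : A = B by [].
  by rewrite B0; apply/cardfs0_eq; move: cardA; rewrite -cardB B0 cardfs0; lia.
have m0 : (0 < m)%N by exact: leq_trans (Bpos _ c0B) (Bm _ c0B).
pose out (C D : {fset cell}) := [fset c in C | c \notin D]%fset.
have outAB : \sum_(c <- out A B) cell_weight R c <= #|` out A B|%:R * m%:R^-1.
  rewrite card_fset_sum1 natr_sum mulr_suml big_seq [leRHS]big_seq.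
  apply: ler_sum => c; rewrite !inE/= => /andP[cA cB].
  by rewrite mul1r lef_pV2 ?posrE ?ltr0n// ?ler_nat ?mB//; exact: A0.
have outBA : #|` out B A|%:R * m%:R^-1 <= \sum_(c <- out B A) cell_weight R c.
  rewrite card_fset_sum1 natr_sum mulr_suml big_seq [leRHS]big_seq.
  apply: ler_sum => c; rewrite !inE/= => /andP[cB cA].
  by rewrite mul1r lef_pV2 ?posrE ?ltr0n// ?ler_nat ?Bm//; exact: Bpos.
have cardE C D : #|` C| = (#|` [fset c in C | c \in D]%fset| + #|` out C D|)%N.
  by rewrite !card_fset_sum1 (big_fsetID addn (mem D)).
have ABE : [fset c in A | c \in B]%fset = [fset c in B | c \in A]%fset.
  by apply/fsetP => c; rewrite !inE andbC.
have cardAB : (#|` out A B| <= #|` out B A|)%N.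
  by move: cardA; rewrite -cardB (cardE A B) (cardE B A) ABE leq_add2l.
rewrite /board_weight (big_fsetID +%R (mem B) A) (big_fsetID +%R (mem A) B)/=.
rewrite ABE lerD2l (le_trans outAB)// (le_trans _ outBA)//.
by rewrite ler_wpM2r ?invr_ge0// ler_nat.
Qed.

Lemma optimal_board_ge (R : realType) N B : (0 < N)%N ->
  (forall A : {fset cell}, {in A, forall c, positive_cell c} ->
     (#|` A| <= N)%N -> board_weight R A <= board_weight R B) ->
  harmonic_number R N ^+ 2 / 2 -
    4 * harmonic_number R N * Num.sqrt (harmonic_number R N) <= board_weight R B.
Proof.
move=> N0 Bopt; set h := harmonic_number R N.
have h1 : 1 <= h by rewrite -(harmonic1 R); exact: harmonic_le.
have h0 : 0 <= h by lra.
(* This [k] is at least [h], so the region xy <= N / k has at most (N / k) h <= N cells and is a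
   competitor. *)
pose k := (Num.truncn h).+1.
have hk : h <= k%:R by rewrite ltW// truncnS_gt.
have kh : k%:R <= h + 1 by rewrite -natr1 lerD2r truncn_le.
pose n := (N %/ k)%N.
have nN : (n <= N)%N by exact: leq_div.
have cardn : (size (hyperbola n) <= N)%N.
  rewrite -(ler_nat R) (le_trans (size_hyperbola_le R n))//.
  apply: (@le_trans _ _ (n * k)%:R); last by rewrite ler_nat leq_trunc_div.
  by rewrite natrM ler_wpM2l// (le_trans _ hk)// harmonic_le.
pose A := [fset c in hyperbola n]%fset.
have AE : A =i hyperbola n by move=> c; rewrite !inE.
have : \sum_(c <- hyperbola n) cell_weight R c <= board_weight R B.
  rewrite -(big_fset_uniq _ (hyperbola_uniq n) AE); apply: Bopt.
    move=> [x y]; rewrite AE mem_hyperbola => /and3P[x0 y0 _].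
    by rewrite /positive_cell muln_gt0 x0.
  by rewrite (card_fset_uniq (hyperbola_uniq n) AE).
apply: le_trans; apply: le_trans (sum_hyperbola_ge _ _).
have hn : harmonic_number R n <= h by exact: harmonic_le.
have hkn : h <= harmonic_number R k + harmonic_number R n.
  exact: harmonic_divn_le.
have hks := harmonic_le_sqrt R k; have Hn0 := harmonic_ge0 R n.
set s := Num.sqrt h.
have sE : s ^+ 2 = h by rewrite sqr_sqrtr.
have s1 : 1 <= s by rewrite -(@sqrtr1 R) ler_sqrt.
(* Since h >= 1, k <= h + 1 <= 2 h <= (3 / 2) ^ 2 h; hence H_k <= 3 s. *)
have ks : Num.sqrt k%:R <= 3 / 2 * s.
  rewrite -(@ler_pXn2r _ 2) ?nnegrE ?sqrtr_ge0//; last by lra.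
  by rewrite sqr_sqrtr// exprMn sE; lra.
have : h - 3 * s <= harmonic_number R n by lra.
move: hn Hn0; set a := harmonic_number R n => ah a0 has.
have : h ^+ 2 - 6 * s * h <= a ^+ 2.
  (* Square h - 3 s <= a if the left side is nonnegative; otherwise h ^ 2 - 6 s h is already
     negative. *)
  by have [hs|hs] := leP (3 * s) h; nra.
by nra.
Qed.

(** * Choice of the error function and attainment of both bounds *)

Lemma harmonic_cvgy (R : realType) : harmonic_number R n @[n --> \oo] --> +oo.
Proof.
apply: nondecreasing_dvgn_lt; first exact: harmonic_le.
rewrite (_ : harmonic_number R = series harmonic); first exact: dvg_harmonic.
by apply/funext => n; rewrite /harmonic_number big_add1.
Qed.

Theorem theorem2 (R : realType) :
  exists eps : nat -> R,
    [/\ eps N @[N --> \oo] --> (0 : R),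
        forall (N : nat) (B : {fset cell}), chomp_board B -> #|` B| = N ->
          harmonic_number R N <= expected_turns R B /\
          expected_turns R B <= (1 / 2%:R + eps N) * harmonic_number R N ^+ 2,
        forall N : nat, exists B : {fset cell},
          [/\ chomp_board B, #|` B| = N &
              expected_turns R B = harmonic_number R N] &
        forall N : nat, exists B : {fset cell},
          [/\ chomp_board B, #|` B| = N &
              expected_turns R B =
                (1 / 2%:R + eps N) * harmonic_number R N ^+ 2]].
Proof.
have [G GP] := choice (optimal_board R).
pose h := harmonic_number R.
(* Defined so that the optimal board [G N] meets the upper bound with equality; what remains is that
   [eps] tends to 0. *)
pose eps N := board_weight R (G N) / h N ^+ 2 - 1 / 2%:R.
have epsE N : (1 / 2%:R + eps N) * h N ^+ 2 = board_weight R (G N).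
  rewrite addrC subrK; have [chG cardG _] := GP N.
  (* For N = 0 the quotient by [h 0 = 0] is a default value, but both sides vanish. *)
  case: N => [|N] in chG cardG *.
    by rewrite /h harmonic0 expr0n mulr0 (cardfs0_eq cardG) /board_weight big_seq_fset0.
  rewrite divfK// expf_neq0// lt0r_neq0// (lt_le_trans ltr01)//.
  by rewrite -(harmonic1 R) harmonic_le.
exists eps; split.
- apply/cvgr0Pnorm_le => e e0.
  (* Once h >= (4 / e) ^ 2, 4 <= e sqrt h, so the error 4 h sqrt h is at most e h ^ 2; h >= 1 lets
     it absorb the error h of the upper bound. *)
  have /cvgryPge /(_ (Num.max 1 ((4 / e) ^+ 2))) := @harmonic_cvgy R.
  apply: filterS => N; rewrite ge_max => /andP[hN1 hNe].
  have N0 : (0 < N)%N by case: N hN1 {hNe} => //; rewrite harmonic0 ler10.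
  have [chG cardG Gopt] := GP N.
  have := board_weight_le R chG; have := optimal_board_ge N0 Gopt.
  rewrite cardG /eps -/(h N); move: hN1 hNe; rewrite -/(h N).
  set a := h N; set w := board_weight R (G N) => a1 ae.
  set s := Num.sqrt a => lew gew.
  have sE : s ^+ 2 = a by rewrite sqr_sqrtr//; lra.
  have s1 : 1 <= s by rewrite -(@sqrtr1 R) ler_sqrt//; lra.
  have es : 4 <= e * s.
    rewrite mulrC -ler_pdivrMr// -(@ler_pXn2r _ 2) ?nnegrE ?sE//; last by lra.
    by rewrite divr_ge0//; lra.
  have as_le : 4 * a * s <= e * a ^+ 2.
    have : 4 * (a * s) <= e * s * (a * s) by rewrite ler_wpM2r// mulr_ge0; lra.
    have -> : e * s * (a * s) = e * a * s ^+ 2 by ring.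
    by rewrite sE; lra.
  have a_le : a <= a * s by rewrite ler_peMr//; lra.
  have a20 : 0 < a ^+ 2 by rewrite exprn_gt0//; lra.
  by rewrite ler_distl ler_pdivlMr// ler_pdivrMr//; apply/andP; split; lra.
- move=> N B chB cardB; rewrite expected_turnsE// epsE -[in harmonic_number R N]cardB.
  split; first exact: board_weight_ge.
  have [_ _ Gopt] := GP N; apply: Gopt; last by rewrite cardB.
  by move=> [x y] /chB.1[x0 y0]; rewrite /positive_cell/= muln_gt0 x0.
- move=> N; pose s : seq cell := [seq (1%N, j) | j <- index_iota 1 N.+1].
  have us : uniq s by rewrite map_inj_uniq ?iota_uniq// => i j [].
  pose B := [fset c in s]%fset; have BE : B =i s by move=> c; rewrite !inE.
  have memB x y : ((x, y) \in B) = (x == 1%N) && (0 < y <= N)%N.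
    rewrite BE; apply/mapP/andP => [[j + [-> ->]]|[/eqP-> yN]].
      by rewrite mem_index_iota.
    by exists y; rewrite ?mem_index_iota.
  have chB : chomp_board B.
    split=> [x y|x y p q]; rewrite !memB; first by lia.
    by move=> /andP[/eqP-> yN] p1 qy; lia.
  exists B; split=> //.
    by rewrite (card_fset_uniq us BE) size_map size_iota subn1.
  rewrite expected_turnsE// /board_weight (big_fset_uniq _ us BE) big_map.
  by apply: eq_bigr => j _; rewrite /cell_weight mul1n.
- move=> N; have [chG cardG _] := GP N; exists (G N); split=> //.
  by rewrite epsE expected_turnsE.
Qed.
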